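(* Let $c$ be a closed, unit-speed curve of length $2\pi$ in $\mathbf{R}^n$ ($n\ge2$), and let $\lambda(s)=2\sin\frac s2$. Then for every $s\in(0,2\pi)$, $$\operatorname{distort}_s(c):=\sup_{t\in\mathbf{R}}\frac{s}{|c(t+s)-c(t)|}\;\ge\;\frac{s}{\lambda(s)},$$ with equality if and only if $c$ is the unit circle; and $$\operatorname{distort}(c):=\sup_{s\in(0,\pi]}\ \sup_{t\in\mathbf{R}}\frac{s}{|c(t+s)-c(t)|}\;\ge\;\frac{\pi}{2},$$ with equality if and only if $c$ is the unit circle.
   Context: A closed unit-speed curve of length $2\pi$ in $\mathbf{R}^n$ is an absolutely continuous map $c\colon S^1=\mathbf{R}/2\pi\mathbf{Z}\to\mathbf{R}^n$ with $|c'(t)|=1$ for almost every $t$. Quotients with zero denominator are interpreted as $+\infty$. ''The unit circle'' means a round circle of radius $1$ in some plane of $\mathbf{R}^n$, traversed once at unit speed. *)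

(* Defs.v *)
From HB Require Import structures.
From mathcomp Require Import all_boot all_order all_algebra.
From mathcomp Require Import all_classical all_reals all_analysis.

Set Implicit Arguments.
Unset Strict Implicit.
Unset Printing Implicit Defensive.

Import Order.TTheory GRing.Theory Num.Theory.
Import numFieldNormedType.Exports.

Local Open Scope classical_set_scope.
Local Open Scope ring_scope.

Section Curves.
Context {R : realType} {n : nat}.
Implicit Types (u v : 'rV[R]_n) (c : R -> 'rV[R]_n).

Definition dotrv u v : R := \sum_(i < n) u ord0 i * v ord0 i.

(* The library norm `|v| on 'rV[R]_n is the sup norm, hence this definition;
   both norms induce the same topology, hence the same derivative of a curve. *)
Definition enorm v : R := Num.sqrt (dotrv v v).

Definition absolutely_continuous (a b : R) c : Prop :=
  forall e : R, 0 < e -> exists2 d : R, 0 < d &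
    forall (m : nat) (x y : 'I_m -> R),
      (forall i, [/\ a <= x i, x i <= y i & y i <= b]) ->
      trivIset setT (fun i => `]x i, y i[%classic) ->
      \sum_(i < m) (y i - x i) < d ->
      \sum_(i < m) enorm (c (y i) - c (x i)) < e.

(* A map on S^1 = R/2piZ is a 2pi-periodic map on R; it is absolutely
   continuous on S^1 iff its restriction to [0, 2pi] is. *)
Definition closed_unit_speed c : Prop :=
  [/\ forall t, c (t + 2 * pi) = c t,
      absolutely_continuous 0 (2 * pi) c
    & {ae (@lebesgue_measure R), forall t,
        derivable c t 1 /\ enorm (derive1 c t) = 1} ].

(* Starting point and orientation are absorbed in the choice of the
   orthonormal frame (u, v) of the plane; a is the centre. *)
Definition is_unit_circle c : Prop :=
  exists a u v, [/\ dotrv u u = 1, dotrv v v = 1, dotrv u v = 0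
    & forall t, c t = a + cos t *: u + sin t *: v].

(* Division in \bar R, where 0^-1 = +oo: for 0 < s the quotient is +oo
   whenever c (t + s) = c t. *)
Definition distort_at (s : R) c : \bar R :=
  ereal_sup [set (s%:E / (enorm (c (t + s) - c t))%:E)%E | t in [set: R]].

Definition distort c : \bar R :=
  ereal_sup [set distort_at s c | s in `]0, pi]%classic].

End Curves.

Definition chord {R : realType} (s : R) : R := 2 * sin (s / 2).

(* Main.v *)
Require Import Defs.
From HB Require Import structures.
From mathcomp Require Import all_boot all_order all_algebra.
From mathcomp Require Import all_classical all_reals all_analysis.
From mathcomp Require Import measurable_realfun ring lra.

Set Implicit Arguments.
Unset Strict Implicit.
Unset Printing Implicit Defensive.

Import Order.TTheory GRing.Theory Num.Theory.
Import numFieldNormedType.Exports.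

Local Open Scope classical_set_scope.
Local Open Scope ring_scope.

(* Let D(s) be the root mean square over t of
   |c(t+s) - c(t)|. In the Hilbert space of square integrable closed curves,
   Ptolemy's inequality for the translates of c by 0, a, a+b, a+b+d reads
     D(a+b) D(b+d) <= D(a) D(d) + D(a+b+d) D(b),
   and for the unit circle, where D(s) = chord s = 2 sin(s/2), it is an equality.
   Suppose that M = max D / chord is attained at s. Comparing the inequality with
   the equality at (h, s-h, h) gives D(h) >= M chord(h) for all small h; since c is
   1-Lipschitz, D(h) <= h ~ chord(h), so M <= 1. If D(s0) = chord(s0) for one s0,
   the same argument and Ptolemy's inequality force D = chord everywhere. The Gram matrix
   of the translates of c is then that of the translates of the circle, so the affine
   relation on the circle expressing the point t by the points 0, pi/2, pi also holds
   on c, and c is an ellipse, then a unit circle. *)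

(** * Quadratic forms and the Euclidean norm *)

(** The form is the squared length of [a X + b Y] for vectors with lengths [x], [y] and
    [|X + Y| = z]; its positivity is Cauchy-Schwarz. Stated for reals, it serves for vectors, for
    mean square distances and for Ptolemy's inequality. *)
Lemma triangle_of_form (R : realType) (x y z : R) : 0 <= x -> 0 <= y ->
  (forall a b, 0 <= a ^+ 2 * x ^+ 2 + b ^+ 2 * y ^+ 2
                    + a * b * (z ^+ 2 - x ^+ 2 - y ^+ 2)) ->
  z <= x + y.
Proof.
move=> x0 y0 H; set k := z ^+ 2 - x ^+ 2 - y ^+ 2 in H.
suff kxy : k <= 2 * x * y.
  have [//|zxy] := leP z (x + y); exfalso; move: kxy; rewrite /k; nra.
move: x0; rewrite le_eqVlt => /predU1P[x0|x0]; last first.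
  move: y0; rewrite le_eqVlt => /predU1P[y0|y0]; last first.
    have xy0 : 0 < x * y by exact: mulr_gt0.
    have := H y (- x); nra.
  (* Here [y = 0], and the coefficients [- k] and [x ^+ 2 + 1] turn the form into [- k ^+ 2], so
     [k = 0]. *)
  have := H (-1) (x ^+ 2 + 1); have := H ((-1) * k) (x ^+ 2 + 1); rewrite -y0; nra.
have := H (y ^+ 2 + 1) ((-1) * k); rewrite -x0; nra.
Qed.

Section Dot.
Context {R : realType} {n : nat}.
Implicit Types u v w : 'rV[R]_n.

Lemma dotrvC u v : dotrv u v = dotrv v u.
Proof. by apply: eq_bigr => i _; rewrite mulrC. Qed.

Lemma dotrvDl u v w : dotrv (u + v) w = dotrv u w + dotrv v w.
Proof. by rewrite -big_split; apply: eq_bigr => i _; rewrite mxE mulrDl. Qed.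

Lemma dotrvZl a u w : dotrv (a *: u) w = a * dotrv u w.
Proof. by rewrite mulr_sumr; apply: eq_bigr => i _; rewrite mxE mulrA. Qed.

Lemma dotrvDr u v w : dotrv w (u + v) = dotrv w u + dotrv w v.
Proof. by rewrite dotrvC dotrvDl !(dotrvC w). Qed.

Lemma dotrvZr a u w : dotrv w (a *: u) = a * dotrv w u.
Proof. by rewrite dotrvC dotrvZl (dotrvC w). Qed.

Lemma dotrvNl u w : dotrv (- u) w = - dotrv u w.
Proof. by rewrite -scaleN1r dotrvZl mulN1r. Qed.

Lemma dotrvNr u w : dotrv w (- u) = - dotrv w u.
Proof. by rewrite dotrvC dotrvNl (dotrvC w). Qed.

Definition dotrvE := (dotrvDl, dotrvDr, dotrvZl, dotrvZr, dotrvNl, dotrvNr).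

Lemma dotrv_ge0 u : 0 <= dotrv u u.
Proof. by apply: sumr_ge0 => i _; rewrite -expr2 sqr_ge0. Qed.

Lemma dotrv_eq0 u : dotrv u u = 0 -> u = 0.
Proof.
move/eqP; rewrite psumr_eq0; last by move=> i _; rewrite -expr2 sqr_ge0.
move/allP => H; apply/rowP => i; rewrite mxE.
by have := H i (mem_index_enum _); rewrite /= mulf_eq0 orbb => /eqP.
Qed.

Lemma enorm_ge0 v : 0 <= enorm v. Proof. exact: sqrtr_ge0. Qed.

Lemma enorm_sqr v : enorm v ^+ 2 = dotrv v v.
Proof. by rewrite sqr_sqrtr// dotrv_ge0. Qed.

Lemma enormN v : enorm (- v) = enorm v.
Proof. by rewrite /enorm dotrvNl dotrvNr opprK. Qed.

Lemma enorm0 : enorm (0 : 'rV[R]_n) = 0.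
Proof. by rewrite /enorm -(scale0r 0) dotrvZl mul0r sqrtr0. Qed.

Lemma enormZ a v : enorm (a *: v) = `|a| * enorm v.
Proof.
by rewrite /enorm dotrvZl dotrvZr mulrA -expr2 sqrtrM ?sqr_ge0// sqrtr_sqr.
Qed.

Lemma enormD u v : enorm (u + v) <= enorm u + enorm v.
Proof.
apply: triangle_of_form; rewrite ?enorm_ge0// => a b.
have := dotrv_ge0 (a *: u + b *: v); rewrite !enorm_sqr !dotrvE (dotrvC v u).
by congr (_ <= _); ring.
Qed.

Lemma enorm_le_norm v : enorm v <= n%:R * `|v|.
Proof.
rewrite -(@ler_pXn2r _ 2) ?nnegrE ?enorm_ge0 ?mulr_ge0//.
rewrite enorm_sqr exprMn (@le_trans _ _ (n%:R * `|v| ^+ 2))//.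
  rewrite mulr_natl -[X in _ *+ X]card_ord -sumr_const ler_sum// => i _.
  rewrite -expr2 -real_normK ?num_real// ler_sqr ?nnegrE//.
  by rewrite /Num.norm /= mx_normrE; exact: (le_bigmax _ _ (ord0, i)).
rewrite ler_wpM2r ?sqr_ge0// -natrX ler_nat.
by case: (n) => // m; rewrite leq_pmulr.
Qed.

End Dot.

(** * Unit-speed curves are Lipschitz *)

Lemma derivable_secant_le {R : realType} {n : nat} (c : R -> 'rV[R]_n) (p k e : R) :
  derivable c p 1 -> enorm (derive1 c p) <= k -> 0 < e ->
  exists2 d, 0 < d & forall x, `|x - p| < d ->
    enorm (c x - c p) <= (k + e) * `|x - p|.
Proof.
move=> dc ck e0.
(* Passing from the sup norm to [enorm] costs a factor [n]; dividing by [n.+1] also covers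
   [n = 0]. *)
have e1 : 0 < e / n.+1%:R by rewrite divr_gt0.
have := dc => /cvgrPdist_lt/(_ _ e1); rewrite -/(derive c p 1) -derive1E.
move=> /nbhs_ballP[d /= d0 dP].
exists d => // x xp; have [->|xNp] := eqVneq x p.
  by rewrite !subrr enorm0 normr0 mulr0.
have xp0 : x - p != 0 by rewrite subr_eq0.
have := dP (x - p); rewrite /ball/= sub0r normrN => /(_ xp xp0).
rewrite [_ *: 1]mulr1 subrK => H.
set q := (x - p)^-1 *: _ in H.
have -> : c x - c p = (x - p) *: q by rewrite scalerA divff// scale1r.
rewrite enormZ mulrC ler_wpM2r//.
have -> : q = derive1 c p + - (derive1 c p - q) by rewrite opprB addrC subrK.
apply: le_trans (enormD _ _) _; rewrite lerD// enormN.
apply: le_trans (enorm_le_norm _) _; apply: le_trans (ler_wpM2l _ (ltW H)) _ => //.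
rewrite mulrCA ler_piMr ?(ltW e0)// ler_pdivrMr// mul1r ler_nat.
exact: leqnSn.
Qed.

(** A form of Cousin's lemma: the supremum of the points reached from [a] is itself reached, and
    could be passed if it were less than [b]. *)
Lemma cousin_induction {R : realType} (a b : R) (Q : R -> R -> Prop) : a <= b ->
  (forall x y z, x <= y -> y <= z -> Q x y -> Q y z -> Q x z) ->
  (forall p, a <= p <= b -> exists2 d, 0 < d &
     forall x y, p - d < x -> x <= p -> p <= y -> y < p + d -> Q x y) ->
  Q a b.
Proof.
move=> ab Qtrans Qloc.
pose S := [set x | a <= x <= b /\ Q a x].
have Sa : S a.
  split; first by rewrite lexx ab.
  have [|d d0] := Qloc a; first by rewrite lexx ab.
  by apply=> //; [rewrite ltrBlDr ltrDl|rewrite ltrDl].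
have supS : has_sup S by split; [exists a|exists b => x [/andP[]]].
have aS : a <= sup S by exact: (sup_upper_bound supS).
have Sb : sup S <= b by apply: ge_sup; [exists a|move=> x [/andP[]]].
have [|d d0 dP] := Qloc (sup S); first by rewrite aS Sb.
have [x Sx xS] := sup_adherent d0 supS.
have xleS : x <= sup S by exact: (sup_upper_bound supS).
have [/andP[ax xb] Qax] := Sx.
have step y : sup S <= y -> y < sup S + d -> Q a y.
  by move=> y1 y2; apply: (Qtrans a x y) => //; [exact: le_trans y1|exact: dP].
move: Sb; rewrite le_eqVlt => /predU1P[Sb|Sb].
  by rewrite -Sb; apply: step; rewrite ?ltrDl.
pose y := Num.min b (sup S + d / 2).
have yS : sup S < y by rewrite lt_min Sb ltrDl divr_gt0.
have Sy : S y.
  split; first by rewrite ge_min lexx (le_trans aS (ltW yS)).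
  apply: step; first exact: ltW.
  by rewrite gt_min (ltrD2l (sup S)) ltr_pdivrMr// ltr_pMr// ltr1n orbT.
by have := sup_upper_bound supS Sy; rewrite leNgt yS.
Qed.

(** Outer regularity of Lebesgue measure, applied to a null set containing the exceptions. *)
Lemma negligible_open_cover {R : realType} (P : R -> Prop) (d : R) :
  {ae (@lebesgue_measure R), forall t, P t} -> 0 < d ->
  exists U : set R, [/\ open U, forall t, ~ U t -> P t
    & (lebesgue_measure U < d%:E)%E].
Proof.
move=> [N [mN N0 subN]] d0.
have [|U [oU NU Ud]] := @lebesgue_regularity_outer R N d mN _ d0.
  by rewrite [ltLHS](_ : _ = 0%E) ?ltry.
exists U; split => // [t Ut|].
  by apply: contrapT => Pt; apply: Ut; apply: NU; exact: subN.
have mU : measurable U by exact: open_measurable.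
rewrite -(setDUK NU); apply: le_lt_trans Ud.
rewrite measureU//; first by rewrite [X in (X + _)%E](_ : _ = 0%E)// add0e.
- exact: measurableD.
- by rewrite setDIK.
Qed.

(** Ordered lists of intervals can be concatenated, which suits the gluing step of
    [cousin_induction]. *)
Lemma absolutely_continuous_seq {R : realType} {n : nat} (c : R -> 'rV[R]_n)
    (a b e : R) : absolutely_continuous a b c -> 0 < e ->
  exists2 d, 0 < d & forall s : seq (R * R),
    all (fun q => [&& a <= q.1, q.1 <= q.2 & q.2 <= b]) s ->
    pairwise (fun p q => p.2 <= q.1) s ->
    \sum_(q <- s) (q.2 - q.1) < d ->
    \sum_(q <- s) enorm (c q.2 - c q.1) < e.
Proof.
move=> ac e0; have [d d0 dP] := ac _ e0; exists d => // s sab sp.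
rewrite !(big_nth (0, 0)) !big_mkord.
apply: dP => [i|i j _ _ [t /= []]].
  by have /and3P[] := allP sab _ (mem_nth (0, 0) (ltn_ord i)).
rewrite !in_itv/= => /andP[t1 t2] /andP[t3 t4].
have /pairwiseP/= sP := sp.
have [ij|ji|ij] := ltngtP i j; last exact: val_inj.
- have /= := sP (0, 0) _ _ (ltn_ord i) (ltn_ord j) ij.
  by rewrite leNgt (lt_trans t3 t2).
- have /= := sP (0, 0) _ _ (ltn_ord j) (ltn_ord i) ji.
  by rewrite leNgt (lt_trans t1 t4).
Qed.

(* The exceptional null set is covered by an open set U of small measure; an
   increment of c is split into secants with slope at most 1 + e, and
   increments over disjoint intervals inside U, whose sum is small. *)
Lemma unit_speed_le {R : realType} {n : nat} (c : R -> 'rV[R]_n) (a b : R) :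
  a <= b -> absolutely_continuous a b c ->
  {ae (@lebesgue_measure R), forall t,
     derivable c t 1 /\ enorm (derive1 c t) = 1} ->
  enorm (c b - c a) <= b - a.
Proof.
move=> ab ac speed; apply/ler_addgt0Pr => e e0.
have ba1 : 0 < b - a + 1 by rewrite ltr_wpDl// subr_ge0.
set e1 := e / (b - a + 1).
have e10 : 0 < e1 by rewrite divr_gt0.
(* The excess slope contributes [e1 * (b - a)] and the intervals inside [U] contribute [e1]. *)
have -> : b - a + e = (1 + e1) * (b - a) + e1.
  by rewrite /e1; field; rewrite gt_eqF.
have [d d0 dP] := absolutely_continuous_seq ac e10.
have [U [oU NU Ud]] := negligible_open_cover speed d0.
have mU : measurable U by exact: open_measurable.
(* The half-open []x, y]] makes the measure inside [U] additive when intervals are glued. *)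
pose Q x y := exists s : seq (R * R),
  [/\ all (fun q => [&& x <= q.1, q.1 <= q.2 & q.2 <= y]) s,
      pairwise (fun p q => p.2 <= q.1) s,
      ((\sum_(q <- s) (q.2 - q.1))%:E <= lebesgue_measure (U `&` `]x, y]%classic))%E
    & enorm (c y - c x) <=
      (1 + e1) * (y - x) + \sum_(q <- s) enorm (c q.2 - c q.1)].
suff [s [sab sp sU cs]] : Q a b.
  apply: le_trans cs _; rewrite lerD2l ltW// dP//.
  rewrite -lte_fin; apply: le_lt_trans sU _; apply: le_lt_trans Ud.
  by apply: le_measure; rewrite ?inE//; exact: measurableI.
apply: cousin_induction => // [x y z xy yz|p pab].
  move=> [s [sxy sp sU cs]] [t [tyz tp tU ct]]; exists (s ++ t); split.
  - rewrite all_cat; apply/andP; split.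
      by apply: sub_all sxy => q /and3P[-> -> /le_trans ->].
    by apply: sub_all tyz => q /and3P[/(le_trans xy) -> -> ->].
  - rewrite pairwise_cat sp tp !andbT; apply/allrelP => q r qs rt.
    have /and3P[_ _ h1] := allP sxy _ qs; have /and3P[h2 _ _] := allP tyz _ rt.
    exact: le_trans h2.
  - rewrite big_cat/= EFinD; apply: le_trans (leeD sU tU) _.
    rewrite -measureU; [|exact: measurableI|exact: measurableI|].
      rewrite -setIUr; apply: le_measure; rewrite ?inE.
      + by apply: measurableI => //; exact: measurableU.
      + exact: measurableI.
      + apply: setIS => r /= []; rewrite !in_itv/= => /andP[r1 r2].
          by rewrite r1 (le_trans r2).
        by rewrite r2 (le_lt_trans xy).
    apply/seteqP; split=> // r [] [_ /=] + [_ /=]; rewrite !in_itv/=.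
    by move=> /andP[_ ry] /andP[]; rewrite ltNge ry.
  - rewrite big_cat/=; have -> : c z - c x = (c z - c y) + (c y - c x).
      by rewrite addrA subrK.
    apply: le_trans (enormD _ _) _; apply: le_trans (lerD ct cs) _.
    by rewrite le_eqVlt; apply/orP; left; apply/eqP; ring.
(* Near a point of [U] the whole interval is listed; near any other point nothing is, and the two
   secants from [p] bound the increment. *)
have [Up|/NU[dp cp]] := pselect (U p).
  have := open_nbhs_nbhs (conj oU Up) => /nbhs_ballP[r /= r0 rU].
  exists r => // x y x1 x2 y1 y2; exists [:: (x, y)].
  have xy : x <= y by exact: le_trans y1.
  split; rewrite /= ?lexx ?xy ?big_seq1//=; last first.
    by rewrite lerDr mulr_ge0 ?subr_ge0// addr_ge0 ?ltW.
  rewrite setIidr.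
    by rewrite lebesgue_measure_itv/= lte_fin; case: ltP => // yx; rewrite lee_fin subr_le0.
  move=> t; rewrite /= in_itv/= => /andP[t1 t2]; apply: rU.
  rewrite /ball/= ltr_norml; apply/andP; split; lra.
have cp1 : enorm (derive1 c p) <= 1 by rewrite cp.
have [r r0 rP] := derivable_secant_le dp cp1 e10.
exists r => // x y x1 x2 y1 y2; exists [::]; split; rewrite ?big_nil//.
rewrite addr0; have -> : c y - c x = (c y - c p) + - (c x - c p).
  by rewrite opprB addrA subrK.
apply: le_trans (enormD _ _) _; rewrite enormN.
have -> : (1 + e1) * (y - x) = (1 + e1) * `|y - p| + (1 + e1) * `|x - p|.
  by rewrite ger0_norm ?subr_ge0// ler0_norm ?subr_le0//; ring.
by apply: lerD; apply: rP; rewrite ltr_norml; apply/andP; split; lra.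
Qed.

(** * Means of continuous periodic functions *)

Section Mean.
Context {R : realType}.
Implicit Types (f g F : R -> R) (a b k : R).
Local Notation mu := (@lebesgue_measure R).

(** The primitive is an integral from [a], hence only a half-line; [a] is later chosen far enough to
    the left. *)
Lemma continuous_primitive f a : continuous f ->
  exists F, forall x, a < x -> is_derive x 1 F (f x).
Proof.
move=> cf; exists (fun x => \int[mu]_(t in `[a, x]) f t)%R => x ax.
have fi : mu.-integrable `[a, x + 1] (EFin \o f).
  by apply: continuous_compact_integrable;
    [exact: segment_compact|exact: continuous_subspaceT].
have [|dF F'] := continuous_FTC1_closed _ fi ax (cf x); first by rewrite ltrDl.
by apply: DeriveDef; [exact: dF|rewrite -derive1E; exact: F'].
Qed.

Lemma primitive_increment F f a b : a <= b ->
  (forall x, a <= x <= b -> is_derive x 1 F (f x)) ->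
  exists2 x, a <= x <= b & F b - F a = f x * (b - a).
Proof.
move=> ab dF; have [x xab||x] := @MVT_segment R F f a b ab.
- by apply: dF; move: xab; rewrite in_itv/= => /andP[/ltW -> /ltW ->].
- by apply: derivable_within_continuous => x; rewrite in_itv/= => /dF[].
- by rewrite in_itv/= => xab Fab; exists x.
Qed.

Lemma Rintegral_primitive F f a b : a < b -> continuous f ->
  (forall x, a <= x <= b -> is_derive x 1 F (f x)) ->
  (\int[mu]_(t in `[a, b]) f t)%R = F b - F a.
Proof.
move=> ab cf dF; rewrite /Rintegral (@continuous_FTC2 _ f F)//.
- exact: continuous_subspaceT.
- have cF x : a <= x <= b -> {for x, continuous F}.
    by move=> /dF[dFx _]; apply/differentiable_continuous/derivable1_diffP.
  split.
  + move=> x; rewrite in_itv/= => /andP[/ltW ax /ltW xb].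
    have abx : a <= x <= b by rewrite ax.
    by case: (dF x abx).
  + by apply: cvg_at_right_filter; apply: cF; rewrite lexx ltW.
  + by apply: cvg_at_left_filter; apply: cF; rewrite lexx ltW.
- move=> x; rewrite in_itv/= => /andP[/ltW ax /ltW xb].
  have abx : a <= x <= b by rewrite ax.
  by rewrite derive1E; case: (dF x abx).
Qed.

Definition mean f : R := (2 * pi)^-1 * (\int[mu]_(t in `[- pi, pi]) f t)%R.

Let pi2_gt0 : 0 < (2 * pi : R). Proof. by rewrite mulr_gt0// pi_gt0. Qed.

Let integrable_continuous f : continuous f -> mu.-integrable `[- pi, pi] (EFin \o f).
Proof.
by move=> cf; apply: continuous_compact_integrable;
  [exact: segment_compact|exact: continuous_subspaceT].
Qed.

Lemma mean_cst k : mean (fun=> k) = k.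
Proof.
rewrite /mean Rintegral_cst//= [X in fine X]lebesgue_measure_itv/= lte_fin.
have p0 := @pi_gt0 R; have -> : - pi < pi :> R by lra.
have -> : fine (pi%:E + (- - pi)%:E) = 2 * pi :> R by rewrite /=; ring.
by rewrite mulrC mulfK// gt_eqF.
Qed.

Lemma mean_linear k f g : continuous f -> continuous g ->
  mean (fun t => k * f t + g t) = k * mean f + mean g.
Proof.
move=> cf cg; rewrite /mean RintegralD//=; last first.
- exact: integrable_continuous.
- by apply: integrable_continuous => x; apply: cvgM; [exact: cvg_cst|exact: cf].
by rewrite RintegralZl//; [ring|exact: integrable_continuous].
Qed.

Lemma le_mean f g : continuous f -> continuous g ->
  (forall t, f t <= g t) -> mean f <= mean g.
Proof.
move=> cf cg fg; rewrite ler_pM2l ?invr_gt0//.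
by apply: le_Rintegral => //; exact: integrable_continuous.
Qed.

(** For a primitive [F], the increment over one period starting at [t] has derivative zero by
    periodicity, so it does not depend on [t]. *)
Lemma mean_shift f a : continuous f -> (forall t, f (t + 2 * pi) = f t) ->
  mean (fun t => f (t + a)) = mean f.
Proof.
move=> cf fper; congr (_ * _); have p0 := @pi_gt0 R.
have [F dF] := @continuous_primitive f (- pi - `|a| - 1) cf.
have na := ler_norm a; have nNa := ler_norm (- a); rewrite normrN in nNa.
have dFa b x : - pi - `|a| <= x + b -> is_derive x 1 (fun t => F (t + b)) (f (x + b)).
  move=> xb; have dFb : is_derive (x + b) 1 F (f (x + b)) by apply: dF; lra.
  by have := @is_derive1_comp R F (shift b) x _ _ dFb (is_derive_shift x 1 b); rewrite mulr1.
have -> : (\int[mu]_(t in `[- pi, pi]) f (t + a))%R = F (pi + a) - F (- pi + a).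
  apply: (@Rintegral_primitive (fun t => F (t + a))); first lra.
  - by move=> x; apply: continuous_comp; [apply: cvgD; [exact: cvg_id|exact: cvg_cst]|exact: cf].
  - by move=> x /andP[x1 x2]; apply: dFa; lra.
have -> : (\int[mu]_(t in `[- pi, pi]) f t)%R = F pi - F (- pi).
  by apply: Rintegral_primitive => // [|x /andP[x1 x2]]; [|apply: dF]; lra.
(* Writing [t + 0] lets [dFa] differentiate both terms. *)
pose G t := F (t + 2 * pi) - F (t + 0).
have dG x : - pi - `|a| <= x -> is_derive x 1 G 0.
  move=> xa; have d1 : is_derive x 1 (fun t => F (t + 2 * pi)) (f (x + 2 * pi)).
    by apply: dFa; lra.
  have d2 : is_derive x 1 (fun t => F (t + 0)) (f (x + 0)) by apply: dFa; lra.
  by have := is_deriveB d1 d2; rewrite fper addr0 subrr.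
have Gconst x y : - pi - `|a| <= x -> x <= y -> G x = G y.
  move=> xa xy; apply/eqP; rewrite eq_sym -subr_eq0.
  have [|z _ ->] := @primitive_increment G (fun=> 0) x y xy.
    by move=> z /andP[xz _]; apply: dG; exact: le_trans xz.
  by rewrite mul0r.
have -> : F (pi + a) - F (- pi + a) = G (- pi + a).
  by rewrite /G addr0; congr (F _ - _); ring.
have -> : F pi - F (- pi) = G (- pi).
  by rewrite /G addr0; congr (F _ - _); ring.
have [a0|a0] := leP 0 a; [apply/esym|]; apply: Gconst; lra.
Qed.

(** If [f 0] were positive, [f] would be positive on some [[0, r]]; the mean value theorem on
    [[-pi, 0]], [[0, r]] and [[r, pi]] then makes the integral positive. *)
Lemma mean_eq0 f : continuous f -> (forall t, 0 <= f t) -> mean f = 0 -> f 0 = 0.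
Proof.
move=> cf f0 /eqP; rewrite mulf_eq0 invr_eq0 gt_eqF//= => /eqP.
have p0 := @pi_gt0 R.
have [F dF] := @continuous_primitive f (- pi - 1) cf.
have -> : (\int[mu]_(t in `[- pi, pi]) f t)%R = F pi - F (- pi).
  by apply: Rintegral_primitive => // [|x /andP[x1 x2]]; [|apply: dF]; lra.
move=> Fpi; apply/eqP; rewrite eq_le f0 andbT leNgt; apply/negP => f00.
have /cvgrPdist_lt/(_ _ f00)/nbhs_ballP[d /= d0 dP] := cf 0.
pose r := Num.min (d / 2) pi.
have r0 : 0 < r by rewrite lt_min p0 divr_gt0.
have rpi : r <= pi by rewrite ge_min lexx orbT.
have rd : r < d by rewrite gt_min (_ : d / 2 < d)//; lra.
have dF' x y : - pi <= x -> forall z : R, x <= z <= y -> is_derive z 1 F (f z).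
  by move=> xpi z /andP[xz _]; apply: dF; lra.
have [||x _ E1] := @primitive_increment F f (- pi) 0; [lra|exact: dF'|].
have [||y /andP[y0 yr] E2] := @primitive_increment F f 0 r; [lra|apply: dF'; lra|].
have [||z _ E3] := @primitive_increment F f r pi; [lra|apply: dF'; lra|].
have fy : 0 < f y.
  have /dP/= : ball 0 d y by rewrite /ball/= sub0r normrN ger0_norm//; lra.
  by rewrite ltr_norml => /andP[_]; lra.
have := mulr_ge0 (f0 x) (_ : 0 <= 0 - - pi); have := mulr_ge0 (f0 z) (_ : 0 <= pi - r).
have := mulr_gt0 fy r0; lra.
Qed.

End Mean.

(** * Comparison with the circle *)

(** The form is [|a X + b Y + c Z| ^ 2] written with the lengths [x], [y], [z] and the distances
    [p = |X - Y|], [q = |Y - Z|], [r = |X - Z|]. Ptolemy's inequality is the triangle inequality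
    after inversion at the origin. *)
Lemma ptolemy_of_form {R : realType} (x y z p q r : R) :
  0 <= x -> 0 <= y -> 0 <= z -> 0 <= p -> 0 <= q -> 0 <= r ->
  (forall a b c, 0 <= (a + b + c) * (a * x ^+ 2 + b * y ^+ 2 + c * z ^+ 2)
     - a * b * p ^+ 2 - b * c * q ^+ 2 - a * c * r ^+ 2) ->
  y * r <= x * q + z * p.
Proof.
move=> x0 y0 z0 p0 q0 r0 H.
have ypx : y <= x + p.
  apply: triangle_of_form => // a b; have := H (a - b) b 0; congr (_ <= _); ring.
have rxz : r <= x + z.
  apply: triangle_of_form => // a b; have := H a 0 (- b); congr (_ <= _); ring.
have yqz : y <= q + z.
  apply: triangle_of_form => // a b; have := H 0 a (b - a); congr (_ <= _); ring.
(* A point at the origin cannot be inverted; these cases follow from the triangle inequalities or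
   are trivial. *)
move: (x0); rewrite le_eqVlt => /predU1P[x00|xgt]; first by rewrite -x00 in ypx rxz *; nra.
move: (y0); rewrite le_eqVlt => /predU1P[y00|ygt]; first by rewrite -y00; nra.
move: (z0); rewrite le_eqVlt => /predU1P[z00|zgt]; first by rewrite -z00 in yqz rxz *; nra.
rewrite addrC; apply: triangle_of_form; rewrite ?mulr_ge0// => a b.
(* These are the coefficients of [a (X' - Y') + b (Y' - Z')], scaled by [x * y * z], where
   [X' = X / x ^ 2] and likewise for [Y'], [Z']. *)
have := H (a * (y * z / x)) ((b - a) * (x * z / y)) (- b * (x * y / z)).
by congr (_ <= _); field; rewrite !gt_eqF.
Qed.

Section Chord.
Context {R : realType}.
Implicit Types s h : R.

Lemma chord_gt0 s : 0 < s -> s < 2 * pi -> 0 < chord s.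
Proof. by move=> s0 s1; rewrite mulr_gt0// sin_gt0_pi//; apply/andP; split; lra. Qed.

(** Ptolemy's equality for the isosceles trapezoid with vertices at [0], [h], [s], [s + h] on the
    circle. *)
Lemma chord_ptolemy s h : chord s ^+ 2 - chord h ^+ 2 = chord (s - h) * chord (s + h).
Proof.
rewrite /chord !(mulrDl, mulNr) !sinD sinN cosN.
have := cos2Dsin2 (s / 2); have := cos2Dsin2 (h / 2); nra.
Qed.

Lemma chord_sqr s : chord s ^+ 2 = 2 - 2 * cos s.
Proof.
rewrite /chord [in RHS](_ : s = s / 2 + s / 2); last by lra.
by rewrite cosD; have := cos2Dsin2 (s / 2); nra.
Qed.

Lemma continuous_chord : continuous (@chord R).
Proof.
move=> x; apply: cvgM; first exact: cvg_cst.
by apply: (@continuous_comp _ _ _ (fun t : R => t / 2) sin);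
  [exact: mulrr_continuous|exact: continuous_sin].
Qed.

(** By the mean value theorem [chord h = h * cos x] with [x] small, and [cos x] exceeds [k^-1] near
    0. *)
Lemma chord_near0 k : 1 < k -> exists2 d : R, 0 < d & forall h, 0 < h -> h < d -> h < k * chord h.
Proof.
move=> k1; have k0 : 0 < k by exact: lt_trans k1.
have cos_near : cos x @[x --> (0 : R)] --> (1 : R).
  by rewrite -[X in _ --> X]cos0; exact: continuous_cos.
have e0 : 0 < 1 - k^-1 by rewrite subr_gt0 invf_lt1.
move/cvgrPdist_lt : cos_near => /(_ _ e0)/nbhs_ballP[d /= d0 dP].
exists d => // h h0 hd.
have [x] : exists2 x : R, x \in `[0, h / 2]%R & sin (h / 2) - sin 0 = cos x * (h / 2 - 0).
  apply: MVT_segment; first by lra.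
  by apply: continuous_subspaceT => x; exact: continuous_sin.
rewrite in_itv/= sin0 !subr0 => /andP[x0 xh] Es.
have /dP/= : ball 0 d x by rewrite /ball/= sub0r normrN ger0_norm//; lra.
rewrite ltr_norml => /andP[_ cx]; rewrite /chord Es.
have : 1 < k * cos x by rewrite -ltr_pdivrMl// mulr1; lra.
nra.
Qed.

End Chord.

Section Comparison.
Context {R : realType}.
Implicit Types s t h M a b c : R.
(** [D] abstracts the root mean square chord; [rms_exists] supplies the hypotheses below. *)
Variable D : R -> R.
Hypotheses (D_ge0 : forall s, 0 <= D s) (DN : forall s, D (- s) = D s)
  (D2pi : forall s, D (s + 2 * pi) = D s) (D_le : forall s, 0 <= s -> D s <= s)
  (D_triangle : forall s t, D (s + t) <= D s + D t)
  (D_ptolemy : forall a b c,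
     D (a + b) * D (b + c) <= D a * D c + D (a + b + c) * D b).

Let D_le_norm s : D s <= `|s|.
Proof.
by have [s0|s0] := leP 0 s; [rewrite ger0_norm// D_le|rewrite ltr0_norm// -DN D_le// oppr_ge0 ltW].
Qed.

Let D_continuous : continuous D.
Proof.
move=> x; apply/cvgrPdist_lt => e e0; near=> y.
apply: (@le_lt_trans _ _ `|x - y|); last by near: y; exact: cvgr_dist_lt.
apply: le_trans (D_le_norm _).
rewrite ler_norml; apply/andP; split.
  have := D_triangle x (- (x - y)); rewrite DN (_ : x + _ = y); lra.
by have := D_triangle y (x - y); rewrite (_ : y + _ = x); lra.
Unshelve. all: by end_near. Qed.

(* A maximum M of D / chord attained at s propagates to all small h:
   Ptolemy's inequality for D against the equality [chord_ptolemy] gives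
   (M chord h)^2 <= (D h)^2. *)
Let ratio_propagates M s h : 0 < s -> s < 2 * pi -> 0 < h -> h < s -> h < 2 * pi - s ->
  (forall t, 0 < t -> t < 2 * pi -> D t <= M * chord t) ->
  M * chord s <= D s -> M * chord h <= D h.
Proof.
move=> s0 s1 h0 h1 h2 DM Ms.
have D1 := DM (s - h) ltac:(lra) ltac:(lra).
have D2 := DM (s + h) ltac:(lra) ltac:(lra).
have := D_ptolemy h (s - h) h.
rewrite subrK (_ : h + (s - h) = s); last by ring.
have cs : 0 < chord s by exact: chord_gt0.
have ch : 0 < chord h by apply: chord_gt0; lra.
have c1 : 0 < chord (s - h) by apply: chord_gt0; lra.
have c2 : 0 < chord (s + h) by apply: chord_gt0; lra.
have M0 : 0 <= M.
  by rewrite -(pmulr_lge0 _ cs); apply: le_trans (DM s s0 s1).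
have := chord_ptolemy s h.
move=> E P.
have hD : D (s + h) * D (s - h) <= (M * chord (s + h)) * (M * chord (s - h)).
  by apply: ler_pM.
have hs : (M * chord s) * (M * chord s) <= D s * D s by apply: ler_pM => //; rewrite mulr_ge0// ltW.
rewrite -(@ler_pXn2r _ 2) ?nnegrE//; last by rewrite mulr_ge0// ltW.
have : M ^+ 2 * (chord s ^+ 2 - chord h ^+ 2) =
    M ^+ 2 * (chord (s - h) * chord (s + h)) by rewrite E.
nra.
Qed.

Lemma le_chord s : 0 < s -> s < 2 * pi -> D s <= chord s.
Proof.
move=> s0 s1; rewrite leNgt; apply/negP => Ds.
have cs : 0 < chord s by exact: chord_gt0.
set k := D s / chord s.
have k1 : 1 < k by rewrite ltr_pdivlMr// mul1r.
have [d d0 dP] := chord_near0 k1.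
have Dd h : 0 < h -> h < d -> D h < k * chord h.
  by move=> h0 hd; apply: le_lt_trans (dP h h0 hd); apply: D_le; exact: ltW.
(* The quotient [D / chord] is maximised on the compact [[u, 2 * pi - u]], which contains [s];
   closer to the ends it stays below [k], its value at [s]. *)
pose u := Num.min (Num.min s (2 * pi - s)) (d / 2).
have u0 : 0 < u by rewrite !lt_min s0 subr_gt0 s1 divr_gt0.
have [us us' ud] : [/\ u <= s, u <= 2 * pi - s & u < d].
  by split; rewrite ?ge_min ?lexx ?orbT//= gt_min (_ : d / 2 < d) ?orbT//; lra.
have [x] : exists2 x, x \in `[u, 2 * pi - u]%R &
    forall t, t \in `[u, 2 * pi - u]%R -> D t / chord t <= D x / chord x.
  apply: (@EVT_max _ (fun t => D t / chord t)); first by lra.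
  apply: continuous_in_subspaceT => t; rewrite inE/= in_itv/= => /andP[t1 t2].
  apply: cvgM; first exact: D_continuous.
  apply: cvgV; last exact: continuous_chord.
  by rewrite gt_eqF// chord_gt0//; lra.
rewrite in_itv/= => /andP[x1 x2] xmax.
set M := D x / chord x in xmax.
have kM : k <= M by apply: xmax; rewrite in_itv/=; apply/andP; split; lra.
have cx : 0 < chord x by rewrite chord_gt0//; lra.
have chord_refl t : chord (2 * pi - t) = chord t.
  rewrite /chord (_ : (2 * pi - t) / 2 = pi - t / 2); last by field.
  by rewrite sinB sinpi cospi; ring.
have D_refl t : D (2 * pi - t) = D t by rewrite addrC D2pi.
have Dsmall t : 0 < t -> t < u -> D t <= M * chord t.
  move=> t0 tu; apply: ltW; apply: lt_le_trans (Dd _ t0 _) _; first by lra.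
  by rewrite ler_wpM2r// ltW// chord_gt0//; lra.
have DM t : 0 < t -> t < 2 * pi -> D t <= M * chord t.
  move=> t0 t1; have [tu|ut] := ltP t u; first exact: Dsmall.
  have [tu'|ut'] := ltP (2 * pi - u) t.
    by rewrite -D_refl -chord_refl; apply: Dsmall; lra.
  rewrite -ler_pdivrMr ?chord_gt0//; apply: xmax.
  by rewrite in_itv/= ut.
have Mx : M * chord x <= D x by rewrite /M divfK ?gt_eqF.
(* This contradicts [Dd] at [u / 2], because [k <= M]. *)
have : M * chord (u / 2) <= D (u / 2) by apply: (@ratio_propagates M x) => //; lra.
rewrite leNgt => /negP; apply; apply: lt_le_trans (Dd _ _ _) _; [lra|lra|].
by rewrite ler_wpM2r// ltW// chord_gt0//; lra.
Qed.

(** Equality spreads from [s0] to all small arcs by [ratio_propagates] with [M = 1]; Ptolemy's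
    inequality then doubles the range at each induction step. *)
Lemma eq_chord s0 s : 0 < s0 -> s0 < 2 * pi -> D s0 = chord s0 ->
  0 < s -> s < 2 * pi -> D s = chord s.
Proof.
move=> s00 s01 Ds0 s1 s2.
have DM t : 0 < t -> t < 2 * pi -> D t <= 1 * chord t.
  by move=> t0 t1; rewrite mul1r; exact: le_chord.
pose w := Num.min s0 (2 * pi - s0).
have w0 : 0 < w by rewrite lt_min s00 subr_gt0.
have [w1 w2] : w <= s0 /\ w <= 2 * pi - s0 by split; rewrite ge_min lexx ?orbT.
suff H n t : 0 < t -> t < 2 * pi -> t < 2 ^+ n * w -> D t = chord t.
  have [n sn] : exists n, s / w < 2 ^+ n.
    by exists (Num.bound (s / w)); exact: upper_nthrootP.
  by apply: (H n) => //; rewrite -ltr_pdivrMr.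
elim: n t => [|n IH] t t0 t1 tw.
  apply/le_anti/andP; split; first exact: le_chord.
  rewrite expr0 mul1r in tw; have := @ratio_propagates 1 s0 t; rewrite !mul1r.
  by apply => //; rewrite ?Ds0//; lra.
have [|nt] := ltP t (2 ^+ n * w); first exact: IH.
rewrite exprS -mulrA in tw.
pose sg := 2 ^+ n * w; rewrite -/sg in tw nt.
(* The midpoint of [t - sg] and [t / 2]: thus [t - a < sg] and [t - 2 a] is positive. *)
pose a := (t - sg + t / 2) / 2.
have [a0 b0] : 0 < a /\ 0 < t - a - a by rewrite /a; split; lra.
have ta : t - a < sg by rewrite /a; lra.
have DE x : 0 < x -> x <= t - a -> D x = chord x.
  by move=> x0 xta; apply: IH => //; rewrite -/sg; lra.
have := D_ptolemy a (t - a - a) a.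
rewrite subrK (_ : a + (t - a - a) = t - a); last by ring.
rewrite subrK (DE (t - a)) ?(DE a) ?(DE (t - a - a)); try lra.
(* In Ptolemy's inequality for the arcs [a], [t - 2 a], [a], only [D t] is still unknown; the
   circle's equality bounds it below by [chord t]. *)
have := chord_ptolemy (t - a) a.
rewrite subrK => E P.
apply/le_anti; rewrite le_chord//=.
have cb : 0 < chord (t - a - a) by apply: chord_gt0; lra.
by rewrite -(ler_pM2r cb); nra.
Qed.

End Comparison.

(** * Mean square chords of a closed curve *)

(** [unit_speed_le] covers one period; periods are glued by the triangle inequality, and a shift by
    full periods makes both parameters nonnegative. *)
Lemma closed_unit_speed_lipschitz {R : realType} {n : nat} (c : R -> 'rV[R]_n) x y :
  closed_unit_speed c -> enorm (c x - c y) <= `|x - y|.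
Proof.
move=> [per ac speed].
have p0 : 0 < 2 * pi :> R by rewrite mulr_gt0// pi_gt0.
have pern := periodicn (per : periodic c (2 * pi)).
have base (s t : R) : 0 <= s -> s <= t -> t <= 2 * pi -> enorm (c t - c s) <= t - s.
  move=> s0 st tpi; apply: unit_speed_le => // e /ac[d d0 dP]; exists d => // m u v uv.
  by apply: dP => i; have [su -> vt] := uv i; split; [exact: le_trans su| |exact: le_trans tpi].
have pos m (s t : R) : 0 <= s -> s <= t -> t <= 2 * pi *+ m -> enorm (c t - c s) <= t - s.
  elim: m s t => [|m IH] s t s0 st.
    rewrite mulr0n => t0; have -> : s = t by lra.
    by rewrite !subrr enorm0.
  rewrite mulrSr => tm; set k := 2 * pi *+ m in IH tm.
  have [tk|kt] := leP t k; first exact: IH.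
  have shift u : c u = c (u - k) by rewrite -[in RHS](pern m) subrK.
  have [ks|sk] := leP k s.
    have -> : t - s = (t - k) - (s - k) by ring.
    by rewrite (shift t) (shift s) base; lra.
  have -> : c t - c s = (c t - c k) + (c k - c s) by rewrite addrA subrK.
  have -> : t - s = (t - k) + (k - s) by ring.
  apply: le_trans (enormD _ _) _; apply: lerD; last by apply: IH => //; exact: ltW.
  rewrite (shift t) (shift k) -[leRHS](_ : t - k - (k - k) = _); last by ring.
  by rewrite base; lra.
suff mono (s t : R) : s <= t -> enorm (c t - c s) <= t - s.
  have [xy|yx] := leP y x; first by rewrite ger0_norm ?subr_ge0// mono.
  by rewrite ltr0_norm ?subr_lt0// -enormN !opprB mono// ltW.
move=> st; pose m := Num.bound (`|s| / (2 * pi)); pose m' := Num.bound (`|t| / (2 * pi)).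
have archi (u : R) : `|u| <= 2 * pi *+ Num.bound (`|u| / (2 * pi)).
  rewrite -mulr_natl -ler_pdivrMr//.
  apply/ltW/archi_boundP.
  by rewrite divr_ge0// ltW.
have -> : t - s = (t + 2 * pi *+ m) - (s + 2 * pi *+ m) by ring.
rewrite -(pern m t) -(pern m s); apply: (pos (m' + m)%N).
- have := archi s; have := ler_norm (- s); rewrite normrN -/m; lra.
- by rewrite lerD2r.
- by rewrite mulrnDr lerD2r; apply: le_trans (archi t); exact: ler_norm.
Qed.

Section CurveMean.
Context {R : realType} {n : nat} (c : R -> 'rV[R]_n).
Hypothesis c_per : forall t, c (t + 2 * pi) = c t.
Hypothesis c_lip : forall x y, enorm (c x - c y) <= `|x - y|.
Implicit Types a b d s t x y z : R.

Let sqd x y t := enorm (c (t + x) - c (t + y)) ^+ 2.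

Let sqd_continuous x y : continuous (sqd x y).
Proof.
suff cf : continuous (fun t => enorm (c (t + x) - c (t + y))).
  by move=> t; rewrite /sqd; under eq_fun do rewrite expr2; apply: cvgM; exact: cf.
have half s t : enorm (c (s + x) - c (s + y)) - enorm (c (t + x) - c (t + y)) <= 2 * `|s - t|.
  have -> : c (s + x) - c (s + y) = (c (t + x) - c (t + y)) +
      ((c (s + x) - c (t + x)) - (c (s + y) - c (t + y))).
    by apply/rowP => i; rewrite !mxE; ring.
  rewrite lerBlDl; apply: le_trans (enormD _ _) _; rewrite lerD2l.
  apply: le_trans (enormD _ _) _; rewrite enormN mulr_natl mulr2n.
  by rewrite lerD// (le_trans (c_lip _ _))// opprD addrACA subrr addr0.
move=> t; apply/cvgrPdist_lt => e e0.
apply/nbhs_ballP; exists (e / 2) => /=; first by rewrite divr_gt0.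
move=> s; rewrite /ball/= => ts.
apply: (@le_lt_trans _ _ (2 * `|t - s|)); last by lra.
rewrite ler_norml half andbT lerNl opprB (le_trans (half s t))//.
by rewrite distrC.
Qed.

Let meansq_continuous s : continuous (fun t => enorm (c (t + s) - c t) ^+ 2).
Proof.
suff -> : (fun t => enorm (c (t + s) - c t) ^+ 2) = sqd s 0 by exact: sqd_continuous.
by apply/funext => t; rewrite /sqd addr0.
Qed.

(** The squared distance between [c] and its translate by [s] in the Hilbert space of closed
    curves. *)
Definition meansq s := mean (fun t => enorm (c (t + s) - c t) ^+ 2).

Let mean_sqd x y : mean (sqd x y) = meansq (x - y).
Proof.
rewrite /meansq -[RHS](@mean_shift _ _ y); first last.
- move=> t; rewrite (_ : t + 2 * pi + (x - y) = t + (x - y) + 2 * pi); last by ring.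
  by rewrite !c_per.
- exact: meansq_continuous.
by congr mean; apply/funext => t; rewrite /sqd (_ : t + y + (x - y) = t + x)//; ring.
Qed.

Lemma meansqN s : meansq (- s) = meansq s.
Proof.
rewrite -[in RHS](subr0 s) -(sub0r s) -!mean_sqd; congr mean; apply/funext => t.
by rewrite /sqd -enormN opprB.
Qed.

Lemma meansq2pi s : meansq (s + 2 * pi) = meansq s.
Proof. by congr mean; apply/funext => t; rewrite addrA c_per. Qed.

Lemma meansq0 : meansq 0 = 0.
Proof.
by rewrite -[RHS]mean_cst; congr mean; apply/funext => t; rewrite addr0 subrr enorm0 expr0n.
Qed.

Lemma le_meansq k s : 0 <= k -> (forall t, k <= enorm (c (t + s) - c t)) ->
  k ^+ 2 <= meansq s.
Proof.
move=> k0 ks; rewrite -[leLHS]mean_cst; apply: le_mean => [||t].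
- exact: cst_continuous.
- exact: meansq_continuous.
- by rewrite ler_sqr ?nnegrE ?enorm_ge0.
Qed.

Lemma meansq_le s : meansq s <= s ^+ 2.
Proof.
rewrite -[leRHS]mean_cst; apply: le_mean => [||t].
- exact: meansq_continuous.
- exact: cst_continuous.
- rewrite -[s ^+ 2]real_normK ?num_real// ler_sqr ?nnegrE ?enorm_ge0//.
  by rewrite (le_trans (c_lip _ _))// addrAC subrr add0r.
Qed.

Let w a b d x y z t := a *: (c (t + x) - c t) + b *: (c (t + y) - c t)
  + d *: (c (t + z) - c t).

(** Polarisation leaves only squared distances, whose means are known; the final [+ 0] lets
    [has_mean_step] peel the six terms one by one. *)
Let w_sqd a b d x y z : (fun t => dotrv (w a b d x y z t) (w a b d x y z t)) =
  fun t => (a + b + d) * a * sqd x 0 t + ((a + b + d) * b * sqd y 0 t +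
    ((a + b + d) * d * sqd z 0 t + (- (a * b) * sqd x y t +
    (- (b * d) * sqd y z t + (- (a * d) * sqd x z t + 0))))).
Proof.
apply/funext => t; rewrite /w /sqd !enorm_sqr addr0.
move: (c t) (c (t + x)) (c (t + y)) (c (t + z)) => p u v r.
rewrite !dotrvE (dotrvC u p) (dotrvC v p) (dotrvC r p).
rewrite (dotrvC v u) (dotrvC r u) (dotrvC r v); ring.
Qed.

Let has_mean (f : R -> R) (r : R) := continuous f /\ mean f = r.

Let has_mean_step k x y f r : has_mean f r ->
  has_mean (fun t => k * sqd x y t + f t) (k * meansq (x - y) + r).
Proof.
move=> [cf <-]; split.
  move=> t; apply: cvgD; last exact: cf.
  by apply: cvgM; [exact: cvg_cst|exact: sqd_continuous].
by rewrite -mean_sqd mean_linear//; exact: sqd_continuous.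
Qed.

Let has_mean_w a b d x y z :
  has_mean (fun t => dotrv (w a b d x y z t) (w a b d x y z t))
    ((a + b + d) * (a * meansq x + b * meansq y + d * meansq z)
     - a * b * meansq (x - y) - b * d * meansq (y - z) - a * d * meansq (x - z)).
Proof.
rewrite w_sqd.
set r := (X in has_mean _ X).
have has_mean0 : has_mean (fun=> 0) 0 by split; [exact: cst_continuous|exact: mean_cst].
suff -> : r = (a + b + d) * a * meansq (x - 0) + ((a + b + d) * b * meansq (y - 0) +
    ((a + b + d) * d * meansq (z - 0) + (- (a * b) * meansq (x - y) +
    (- (b * d) * meansq (y - z) + (- (a * d) * meansq (x - z) + 0))))).
  by do 6 apply: has_mean_step.
rewrite /r !subr0; move: (meansq x) (meansq y) (meansq z).
by move: (meansq (x - y)) (meansq (y - z)) (meansq (x - z)) => *; ring.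
Qed.

(** The expression is the mean of the squared length of [w]; this feeds [triangle_of_form] and
    [ptolemy_of_form]. *)
Lemma form_ge0 a b d x y z : 0 <=
  (a + b + d) * (a * meansq x + b * meansq y + d * meansq z)
  - a * b * meansq (x - y) - b * d * meansq (y - z) - a * d * meansq (x - z).
Proof.
have [cw <-] := has_mean_w a b d x y z.
rewrite -[leLHS]mean_cst; apply: le_mean => //; first exact: cst_continuous.
by move=> t; exact: dotrv_ge0.
Qed.

(** A continuous nonnegative function of mean zero vanishes at 0, so a linear relation between
    translates holds on the curve itself. *)
Lemma form_eq0 a b d x y z :
  (a + b + d) * (a * meansq x + b * meansq y + d * meansq z)
  - a * b * meansq (x - y) - b * d * meansq (y - z) - a * d * meansq (x - z) = 0 ->
  a *: (c x - c 0) + b *: (c y - c 0) + d *: (c z - c 0) = 0.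
Proof.
have [cw <-] := has_mean_w a b d x y z; move=> /(mean_eq0 cw) H.
by apply: dotrv_eq0; have := H (fun=> dotrv_ge0 _); rewrite /w !add0r.
Qed.

End CurveMean.

Section RootMeanSquare.
Context {R : realType} {n : nat} (c : R -> 'rV[R]_n).
Hypothesis c_per : forall t, c (t + 2 * pi) = c t.
Hypothesis c_lip : forall x y, enorm (c x - c y) <= `|x - y|.
Implicit Types s t : R.

Lemma meansq_ge0 s : 0 <= meansq c s.
Proof.
by have := @le_meansq _ _ _ c_lip 0 s (lexx _) (fun=> enorm_ge0 _); rewrite expr0n.
Qed.

Lemma rms_exists : exists D : R -> R, [/\ (forall s, 0 <= D s) /\
    (forall s, D s ^+ 2 = meansq c s),
  (forall s, D (- s) = D s) /\ (forall s, D (s + 2 * pi) = D s),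
  forall s, 0 <= s -> D s <= s,
  forall s t, D (s + t) <= D s + D t &
  forall a b d, D (a + b) * D (b + d) <= D a * D d + D (a + b + d) * D b].
Proof.
have [D [D_ge0 D_sqr DN D2pi]] : exists D : R -> R, [/\ forall s, 0 <= D s,
    forall s, D s ^+ 2 = meansq c s, forall s, D (- s) = D s &
    forall s, D (s + 2 * pi) = D s].
  exists (fun s => Num.sqrt (meansq c s)); split=> s.
  - exact: sqrtr_ge0.
  - by rewrite sqr_sqrtr// meansq_ge0.
  - by rewrite meansqN.
  - by rewrite meansq2pi.
have form a b d x y z := form_ge0 c_per c_lip a b d x y z.
exists D; split=> [//|//|s s0|s t|a b d].
- by rewrite -ler_sqr ?nnegrE// D_sqr; exact: meansq_le.
- apply: triangle_of_form => // a b.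
  (* The translates by [s] and [- t] lie at distance [D (s + t)] from each other. *)
  have := form a (- b) 0 s (- t) 0; rewrite -!D_sqr opprK DN.
  by congr (_ <= _); ring.
- apply: ptolemy_of_form => // x y z.
  have := form x y z a (a + b) (a + b + d).
  rewrite (_ : a - (a + b) = - b); last by ring.
  rewrite (_ : a + b - (a + b + d) = - d); last by ring.
  rewrite (_ : a - (a + b + d) = - (b + d)); last by ring.
  by rewrite -!D_sqr !DN; congr (_ <= _); ring.
Qed.

Lemma meansq_le_chord s : 0 < s -> s < 2 * pi -> meansq c s <= chord s ^+ 2.
Proof.
have [D [[D_ge0 D_sqr] [DN D2pi] D_le D_tri D_pto]] := rms_exists.
move=> s0 s1; rewrite -D_sqr ler_sqr ?nnegrE//; last by rewrite ltW// chord_gt0.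
exact: (@le_chord _ D).
Qed.

(** [eq_chord] gives one period; both sides are even and [2 * pi]-periodic. *)
Lemma meansq_eq_chord s0 : 0 < s0 -> s0 < 2 * pi -> chord s0 ^+ 2 <= meansq c s0 ->
  forall s, meansq c s = 2 - 2 * cos s.
Proof.
have [D [[D_ge0 D_sqr] [DN D2pi] D_le D_tri D_pto]] := rms_exists.
move=> s00 s01 eq0.
have Ds0 : D s0 = chord s0.
  apply/le_anti; rewrite (@le_chord _ D)//=.
  by rewrite -ler_sqr ?nnegrE// ?D_sqr// ltW// chord_gt0.
have base s : 0 <= s -> s < 2 * pi -> meansq c s = 2 - 2 * cos s.
  rewrite le_eqVlt => /predU1P[<- _|sgt slt].
    by rewrite meansq0 cos0 mulr1 subrr.
  by rewrite -chord_sqr -D_sqr (eq_chord D_ge0 DN D2pi D_le D_tri D_pto s00).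
move=> s; have p0 : 0 < 2 * pi :> R by rewrite mulr_gt0// pi_gt0.
wlog s1 : s / 0 <= s => [H|].
  have [s1|s1] := leP 0 s; first exact: H.
  by rewrite -(meansqN c_per c_lip) -(cosN s) H// oppr_ge0 ltW.
pose m := Num.truncn (s / (2 * pi)).
have /andP[m1 m2] : m%:R <= s / (2 * pi) < m.+1%:R by apply: truncn_itv; rewrite divr_ge0// ltW.
have -> : s = (s - 2 * pi *+ m) + 2 * pi *+ m by rewrite subrK.
have cos_per := periodicn (@cosD2pi R); rewrite -[pi *+ 2]mulr_natl in cos_per.
rewrite cos_per (periodicn (meansq2pi c_per)).
rewrite base//.
- by rewrite subr_ge0 -[leLHS]mulr_natl -ler_pdivlMr.
- by rewrite ltrBlDr -mulrS -[ltRHS]mulr_natl -ltr_pdivrMr.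
Qed.

End RootMeanSquare.

(** * Circles and distortion *)

Section Circle.
Context {R : realType} {n : nat}.
Implicit Types (c : R -> 'rV[R]_n) (a u v : 'rV[R]_n).

Lemma ellipse_of_meansq c : (forall t, c (t + 2 * pi) = c t) ->
  (forall x y, enorm (c x - c y) <= `|x - y|) ->
  (forall s, meansq c s = 2 - 2 * cos s) ->
  exists a u v, forall t, c t = a + cos t *: u + sin t *: v.
Proof.
move=> c_per c_lip Fc.
exists (2^-1 *: (c 0 + c pi)), (2^-1 *: (c 0 - c pi)), (c (pi / 2) - 2^-1 *: (c 0 + c pi)) => t.
(* On the unit circle these coefficients annihilate the displacements from the point 0 to the points
   [t], [pi / 2], [pi]. *)
have := @form_eq0 _ _ _ c_per c_lip 1 (- sin t) (- ((1 - sin t - cos t) / 2)) t (pi / 2) pi.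
rewrite !Fc cos_pihalf cospi cosBpihalf.
have -> : cos (t - pi) = - cos t by rewrite cosB cospi sinpi; ring.
have -> : cos (pi / 2 - pi) = 0 :> R by rewrite cosB cospi sinpi cos_pihalf; ring.
have sc : sin t ^+ 2 = 1 - cos t ^+ 2 by exact: sin2cos2.
move=> /(_ _)/rowP H; apply/rowP => i.
have {H} := H _ i; rewrite !mxE => H.
rewrite -[LHS](subrK (c 0 ord0 i)) -[_ - _ in LHS]subr0 -[X in _ - X + _]H; last first.
  by field: sc.
by field.
Qed.

(** The chord vector is [chord s] times the velocity at the middle parameter [t + s / 2]. *)
Lemma ellipse_chord c a u v s t : (forall t, c t = a + cos t *: u + sin t *: v) ->
  dotrv (c (t + s) - c t) (c (t + s) - c t) = chord s ^+ 2 *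
    (sin (t + s / 2) ^+ 2 * dotrv u u - 2 * sin (t + s / 2) * cos (t + s / 2) * dotrv u v
     + cos (t + s / 2) ^+ 2 * dotrv v v).
Proof.
move=> cE; set m := t + s / 2.
have -> : c (t + s) - c t = chord s *: (- sin m *: u + cos m *: v).
  rewrite !cE (_ : t + s = m + s / 2); last by rewrite /m; field.
  rewrite (_ : t = m - s / 2); last by rewrite /m; field.
  by rewrite /chord cosB sinB cosD sinD; apply/rowP => i; rewrite !mxE; ring.
by rewrite !dotrvE (dotrvC v u); ring.
Qed.

Lemma circle_chord c s t : is_unit_circle c -> 0 < s -> s < 2 * pi ->
  enorm (c (t + s) - c t) = chord s.
Proof.
move=> [a [u [v [uu vv uv cE]]]] s0 s1.
rewrite /enorm (ellipse_chord _ _ cE) uu vv uv mulr0 subr0 !mulr1 addrC cos2Dsin2 mulr1.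
by rewrite sqrtr_sqr ger0_norm// ltW// chord_gt0.
Qed.

(** The squared speed [q] is at least 1 by the chord bound and at most 1 by the Lipschitz bound on
    short arcs; constant speed 1 makes [u], [v] orthonormal. *)
Lemma unit_circle_of_ellipse c a u v s : (forall t, c t = a + cos t *: u + sin t *: v) ->
  (forall x y, enorm (c x - c y) <= `|x - y|) ->
  0 < s -> s < 2 * pi -> (forall t, chord s <= enorm (c (t + s) - c t)) ->
  is_unit_circle c.
Proof.
move=> cE c_lip s0 s1 cs.
pose q m := sin m ^+ 2 * dotrv u u - 2 * sin m * cos m * dotrv u v + cos m ^+ 2 * dotrv v v.
have q_ge1 m : 1 <= q m.
  have ch := chord_gt0 s0 s1.
  have : chord s ^+ 2 <= enorm (c (m - s / 2 + s) - c (m - s / 2)) ^+ 2.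
    by rewrite ler_sqr ?nnegrE ?enorm_ge0// ltW.
  by rewrite enorm_sqr (ellipse_chord _ _ cE) subrK ler_pMr// exprn_gt0.
have q_le1 m : q m <= 1.
  rewrite leNgt; apply/negP => q1.
  have k1 : 1 < Num.sqrt (q m) by rewrite -[ltLHS]sqrtr1 ltr_sqrt// (lt_trans ltr01).
  have [d d0 dP] := chord_near0 k1.
  have hd := dP (d / 2) ltac:(lra) ltac:(lra).
  set h := d / 2 in hd; set t := m - h / 2.
  have h0 : 0 < h by rewrite /h; lra.
  have : enorm (c (t + h) - c t) ^+ 2 <= h ^+ 2.
    rewrite ler_sqr ?nnegrE ?enorm_ge0 ?(ltW h0)// (le_trans (c_lip _ _))//.
    by rewrite addrAC subrr add0r ger0_norm// ltW.
  rewrite enorm_sqr (ellipse_chord _ _ cE) subrK -/(q m).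
  rewrite leNgt => /negP; apply.
  rewrite -[q m]sqr_sqrtr; last by rewrite ltW// (lt_trans ltr01).
  by rewrite -exprMn mulrC ltr_sqr// nnegrE ltW// (lt_trans h0).
have q1 m : q m = 1 by apply/le_anti; rewrite q_le1 q_ge1.
have vv : dotrv v v = 1 by have := q1 0; rewrite /q sin0 cos0; lra.
have uu : dotrv u u = 1 by have := q1 (pi / 2); rewrite /q sin_pihalf cos_pihalf; lra.
exists a, u, v; split=> //.
(* At parameter 1 both sine and cosine are positive, which isolates [dotrv u v]. *)
have := q1 1; rewrite /q uu vv !mulr1; have := cos2Dsin2 (1 : R).
have s1_gt0 : 0 < sin (1 : R) by rewrite sin2_gt0// ltr01 ltr1n.
have := cos1_gt0 R; set S := sin 1 in s1_gt0 *; set C := cos 1 => C0 CS E.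
have /eqP : (S * C) * dotrv u v = 0 by lra.
by rewrite mulf_eq0 gt_eqF ?mulr_gt0//= => /eqP.
Qed.

(** Jordan's inequality for the sine: by concavity, the slope on [[0, x]] is at least that on
    [[x, pi / 2]]. *)
Lemma div_chord_le_pihalf s : 0 < s -> s <= pi -> s / chord s <= pi / 2 :> R.
Proof.
have p0 := @pi_gt0 R.
move=> s0 spi; rewrite ler_pdivrMr; last by apply: chord_gt0; lra.
rewrite /chord; set x := s / 2.
have [x0 xp] : 0 < x /\ x <= pi / 2 by rewrite /x; split; lra.
have cs := continuous_subspaceT (@continuous_sin R).
have [y] : exists2 y : R, y \in `[0, x]%R & sin x - sin 0 = cos y * (x - 0).
  by apply: MVT_segment => //; exact: ltW.
have [z] : exists2 z : R, z \in `[x, pi / 2]%R &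
    sin (pi / 2) - sin x = cos z * (pi / 2 - x).
  by apply: MVT_segment.
rewrite !in_itv/= sin_pihalf sin0 !subr0 => /andP[z1 z2] Ez /andP[y1 y2] Ey.
have zy : cos z <= cos y.
  by rewrite leNgt ltr_cos -?leNgt ?(le_trans y2)// in_itv/=; apply/andP; split; lra.
have : 0 <= (cos y - cos z) * (x * (pi / 2 - x)).
  by rewrite mulr_ge0 ?subr_ge0// mulr_ge0 ?subr_ge0// ltW.
have : x = s / 2 by [].
nra.
Qed.

End Circle.

Section Distortion.
Context {R : realType} {n : nat} (c : R -> 'rV[R]_n).
Implicit Types s t l : R.
Local Open Scope ereal_scope.

Lemma distort_at_le s l : (0 < s)%R -> (0 < l)%R ->
  distort_at s c <= l%:E <-> forall t, (s / l <= enorm (c (t + s) - c t))%R.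
Proof.
move=> s0 l0; split=> [sl t|sl].
  have : s%:E / (enorm (c (t + s) - c t))%:E <= l%:E.
    by apply: le_trans sl; apply: ereal_sup_ubound; exists t.
  have := enorm_ge0 (c (t + s) - c t); rewrite le_eqVlt => /predU1P[<-|e0].
    (* A vanishing chord makes the quotient [+oo], which no real [l] bounds. *)
    by rewrite inver eqxx gt0_muley ?lte_fin//.
  rewrite inver gt_eqF// -EFinM lee_fin ler_pdivrMr// => H.
  by rewrite ler_pdivrMr// mulrC.
apply: ge_ereal_sup => _ [t _ <-].
have e0 : (0 < enorm (c (t + s) - c t))%R by apply: lt_le_trans (sl t); rewrite divr_gt0.
rewrite inver gt_eqF// -EFinM lee_fin ler_pdivrMr// mulrC -ler_pdivrMr//.
Qed.

Lemma distort_at_ge0 s : (0 < s)%R -> 0 <= distort_at s c.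
Proof.
move=> s0; apply: (@le_trans _ _ (s%:E / (enorm (c (0 + s) - c 0))%:E)).
  by rewrite mule_ge0 ?inve_ge0 ?lee_fin ?enorm_ge0// ltW.
by apply: ereal_sup_ubound; exists 0%R.
Qed.

Hypothesis hc : closed_unit_speed c.

Let c_per t : c (t + 2 * pi) = c t. Proof. by case: hc. Qed.
Let c_lip x y : (enorm (c x - c y) <= `|x - y|)%R.
Proof. exact: closed_unit_speed_lipschitz. Qed.

Lemma chord_le_distort_at s : (0 < s)%R -> (s < 2 * pi)%R ->
  (s / chord s)%:E <= distort_at s c.
Proof.
move=> s0 s1; rewrite leNgt; apply/negP => dlt.
have d0 := distort_at_ge0 s0.
have [r dr] : exists r, distort_at s c = r%:E.
  by exists (fine (distort_at s c)); rewrite fineK// ge0_fin_numE// (lt_trans dlt)// ltry.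
rewrite dr !lte_fin in dlt d0 *; rewrite lee_fin in d0.
have cs := chord_gt0 s0 s1.
have sc : (0 < s / chord s)%R by rewrite divr_gt0.
(* An intermediate bound, positive even if [r = 0]: every chord is then at least [s / l], which
   exceeds [chord s], against [meansq_le_chord]. *)
pose l := ((r + s / chord s) / 2)%R.
have [l0 rl lsc] : [/\ 0 < l, r <= l & l < s / chord s]%R by rewrite /l; split; lra.
have /(distort_at_le s0 l0) sl : distort_at s c <= l%:E by rewrite dr lee_fin.
have sl0 : (0 < s / l)%R by rewrite divr_gt0.
have := le_trans (le_meansq c_lip (ltW sl0) sl) (meansq_le_chord c_per c_lip s0 s1).
rewrite ler_sqr ?nnegrE ?(ltW sl0) ?(ltW cs)//.
by rewrite leNgt ltr_pdivlMr// mulrC -ltr_pdivlMr// lsc.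
Qed.

(** Equality bounds all chords below by [chord s], so the mean square attains its maximum and the
    curve is an ellipse, then a circle. *)
Lemma distort_at_eq s : (0 < s)%R -> (s < 2 * pi)%R ->
  distort_at s c = (s / chord s)%:E <-> is_unit_circle c.
Proof.
move=> s0 s1; have cs := chord_gt0 s0 s1.
have sc : (0 < s / chord s)%R by rewrite divr_gt0.
have E : (s / (s / chord s) = chord s)%R by rewrite invf_div mulrC divfK ?gt_eqF.
split=> [ds|circ].
  have : distort_at s c <= (s / chord s)%:E by rewrite ds.
  move=> /(distort_at_le s0 sc); rewrite E => chord_le.
  have ms := le_meansq c_lip (ltW cs) chord_le.
  have [a [u [v cE]]] := ellipse_of_meansq c_per c_lip (meansq_eq_chord c_per c_lip s0 s1 ms).
  exact: unit_circle_of_ellipse cE c_lip s0 s1 chord_le.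
apply/le_anti; rewrite chord_le_distort_at// andbT.
by apply/(distort_at_le s0 sc) => t; rewrite E circle_chord.
Qed.

Let chordpi : (pi / chord pi = pi / 2 :> R)%R.
Proof. by rewrite /chord sin_pihalf mulr1. Qed.

Let pi_lt : (pi < 2 * pi :> R)%R. Proof. by have := @pi_gt0 R; lra. Qed.

Let distort_ge_at_pi : distort_at pi c <= distort c.
Proof.
by apply: ereal_sup_ubound; exists pi => //=; rewrite in_itv/= pi_gt0 lexx.
Qed.

Lemma pihalf_le_distort : (pi / 2)%:E <= distort c.
Proof.
by rewrite -chordpi (le_trans _ distort_ge_at_pi)// chord_le_distort_at// pi_gt0.
Qed.

(** Equality forces equality at [s = pi]; on the circle, Jordan's inequality bounds the other
    arcs. *)
Lemma distort_eq : distort c = (pi / 2)%:E <-> is_unit_circle c.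
Proof.
split=> [dc|circ].
  apply/(distort_at_eq (@pi_gt0 R) pi_lt); apply/le_anti.
  by rewrite chord_le_distort_at ?pi_gt0// andbT chordpi -dc.
apply/le_anti; rewrite pihalf_le_distort andbT.
apply: ge_ereal_sup => _ [s + <-]; rewrite /= in_itv/= => /andP[s0 spi].
have s1 := le_lt_trans spi pi_lt.
by rewrite (proj2 (distort_at_eq s0 s1) circ) lee_fin div_chord_le_pihalf.
Qed.

End Distortion.

Unset Implicit Arguments.

Theorem corollary3p3 (R : realType) (n : nat) (hn : (2 <= n)%N)
    (c : R -> 'rV[R]_n) (hc : closed_unit_speed c) :
  (forall s : R, 0 < s -> s < 2 * pi ->
     ((s / chord s)%:E <= distort_at s c)%E /\
     (distort_at s c = (s / chord s)%:E <-> is_unit_circle c)) /\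
  (((pi / 2)%:E <= distort c)%E /\
   (distort c = (pi / 2)%:E <-> is_unit_circle c)).
Proof.
split=> [s s0 s1|]; split.
- exact: chord_le_distort_at.
- exact: distort_at_eq.
- exact: pihalf_le_distort.
- exact: distort_eq.
Qed.
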